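(* Let $G$ be a finite, simple, undirected graph on $n$ vertices, and let $\overline{G}$ denote its complement. 1. If $G$ is vertex-transitive or strongly regular, then $\alpha(G\boxtimes\overline{G})=\Theta(G\boxtimes\overline{G})=\vartheta(G\boxtimes\overline{G})=n$. 2. If $G$ is a conference graph, then $\vartheta(G)=\sqrt{n}$. 3. If $G$ is self-complementary and $\alpha(G)=k$, then $\sqrt{n}\le\Theta(G)\le 16\,n^{\frac{k-1}{k+1}}$. 4. If $G$ is self-complementary and is vertex-transitive or strongly regular, then $\Theta(G)=\sqrt{n}=\vartheta(G)$ and $\sqrt{\alpha(G\boxtimes G)}=\Theta(G)$. Hence the minimum Shannon capacity among all self-complementary graphs of order $n$ is attained by those that are vertex-transitive or strongly regular, and equals $\sqrt{n}$.
   Context: All graphs are finite, simple and undirected. $\alpha(G)$ is the independence number. The strong product $G\boxtimes H$ has vertex set $V(G)\times V(H)$, with distinct $(g,h),(g',h')$ adjacent iff ($g=g'$ or $\{g,g'\}\in E(G)$) and ($h=h'$ or $\{h,h'\}\in E(H)$). $G^{\boxtimes k}$ is the $k$-fold strong power, and the Shannon capacity is $\Theta(G)=\sup_{k\ge1}\alpha(G^{\boxtimes k})^{1/k}$. The Lovász $\vartheta$-function of a graph $G$ with vertex set $\{1,\dots,n\}$ is $\vartheta(G)=\max \mathrm{Tr}(BJ_n)$ over all real symmetric positive semidefinite $n\times n$ matrices $B$ with $\mathrm{Tr}(B)=1$ and $B_{i,j}=0$ whenever $\{i,j\}\in E(G)$ ($J_n$ is the all-ones matrix). A graph is self-complementary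 if it is isomorphic to its complement. A strongly regular graph with parameters $(n,d,\lambda,\mu)$ is a $d$-regular graph on $n$ vertices, neither complete nor edgeless, in which every two adjacent vertices have exactly $\lambda$ common neighbours and every two distinct nonadjacent vertices have exactly $\mu$ common neighbours. A conference graph on $n$ vertices is a strongly regular graph with parameters $(n,\tfrac12(n-1),\tfrac14(n-5),\tfrac14(n-1))$, $n\ge5$. A graph is vertex-transitive if its automorphism group acts transitively on its vertices. *)

(* Defs.v *)
From HB Require Import structures.
From mathcomp Require Import all_boot all_order all_algebra.
From mathcomp Require Import fingroup perm.
From mathcomp Require Import all_classical all_reals exp.
Set Implicit Arguments. Unset Strict Implicit. Unset Printing Implicit Defensive.
Import Order.TTheory GRing.Theory Num.Theory.
Local Open Scope ring_scope.
Local Open Scope classical_set_scope.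

Definition simple_graph (T : finType) (e : rel T) : Prop :=
  symmetric e /\ irreflexive e.

Definition compl_graph (T : finType) (e : rel T) : rel T :=
  fun x y => (x != y) && ~~ e x y.

Definition strong_prod (T1 T2 : finType) (e1 : rel T1) (e2 : rel T2)
  : rel (T1 * T2)%type :=
  fun x y => [&& x != y, (x.1 == y.1) || e1 x.1 y.1
                        & (x.2 == y.2) || e2 x.2 y.2].

Definition strong_pow (T : finType) (e : rel T) (k : nat) : rel {ffun 'I_k -> T} :=
  fun f g => (f != g) && [forall i, (f i == g i) || e (f i) (g i)].

Arguments strong_pow {T} e k.

Definition independent (T : finType) (e : rel T) (S : {set T}) : bool :=
  [forall x in S, forall y in S, ~~ e x y].

Definition alpha (T : finType) (e : rel T) : nat :=
  \max_(S : {set T} | independent e S) #|S|.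

Definition shannon_capacity (R : realType) (T : finType) (e : rel T) : R :=
  sup [set powR (alpha (strong_pow e k))%:R (k%:R)^-1 | k in [set k : nat | (1 <= k)%N]].

Definition psd (R : realType) (n : nat) (B : 'M[R]_n) : Prop :=
  forall x : 'cV[R]_n, 0 <= (x^T *m B *m x) 0 0.

Definition lovasz_theta (R : realType) (T : finType) (e : rel T) : R :=
  sup [set \tr (B *m const_mx 1) | B in
        [set B : 'M[R]_#|T| | [/\ B^T = B, psd B, \tr B = 1 &
           forall i j, e (enum_val i) (enum_val j) -> B i j = 0]]].

Definition self_complementary (T : finType) (e : rel T) : Prop :=
  exists s : {perm T}, forall x y, compl_graph e (s x) (s y) = e x y.

Definition vertex_transitive (T : finType) (e : rel T) : Prop :=
  forall x y : T, exists s : {perm T},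
    (forall u v, e (s u) (s v) = e u v) /\ s x = y.

Definition srg_params (T : finType) (e : rel T) (d l m : nat) : Prop :=
  [/\ forall x, #|[set y | e x y]| = d,
      exists x y, (x != y) && ~~ e x y,
      exists x y, e x y,
      forall x y, e x y -> #|[set z | e x z && e y z]| = l
    & forall x y, x != y -> ~~ e x y -> #|[set z | e x z && e y z]| = m].

Definition strongly_regular (T : finType) (e : rel T) : Prop :=
  exists d l m, srg_params e d l m.

Definition conference_graph (T : finType) (e : rel T) : Prop :=
  (5 <= #|T|)%N /\ exists d l m,
    [/\ (2 * d + 1 = #|T|)%N, (4 * l + 5 = #|T|)%N, (4 * m + 1 = #|T|)%N
      & srg_params e d l m].

(* Main.v *)
Require Import Defs.
From HB Require Import structures.
From mathcomp Require Import all_boot all_order all_algebra.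
From mathcomp Require Import fingroup perm.
From mathcomp Require Import all_classical all_reals exp.
From mathcomp Require Import topology normedtype derive.
From mathcomp Require Import ring lra zify.
Set Implicit Arguments.
Unset Strict Implicit.
Unset Printing Implicit Defensive.
Import Order.TTheory GRing.Theory Num.Theory.
Import numFieldNormedType.Exports.
Local Open Scope ring_scope.

(** Call [P] a certificate of value [t] for [G] if its diagonal is constantly [t], it vanishes
    on distinct nonadjacent pairs, and [P - J] is positive semidefinite.  Such a [P] bounds
    [theta G] from above by [t]; being supported on the diagonal and the edges, it is also
    primal feasible for the complement and bounds [theta] there from below by [n / t].
    Certificates multiply under strong products, so they bound independence numbers of
    strong powers.  Everything about [theta] thus reduces to finding certificates for [G] and
    for its complement whose values have product [n].  For a strongly regular graph they are
    read off the eigenvalues.  For a vertex-transitive graph, strong duality (projection on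
    the cone of positive semidefinite matrices plus matrices supported on edges) gives
    certificates of values [theta G] and [theta (compl G)], and averaging feasible matrices
    over the automorphism group gives [theta G * theta (compl G) <= n].

    The bound [16 n ^ ((k - 1) / (k + 1))] needs no [theta]: a self-complementary graph
    with independence number [k] has no [k + 1]-clique either, hence [n <= 4 ^ (k + 1)] by
    Ramsey, and the right-hand side is then at least [n]. *)

(** * Positive semidefinite kernels *)

Section Kernels.
Variables (R : realType) (T : finType).
Implicit Types (K L P Q : T -> T -> R) (x y v : T -> R).

Definition bform K x y : R := \sum_i \sum_j x i * y j * K i j.

Definition psd_kernel K := (forall i j, K i j = K j i) /\ forall x, 0 <= bform K x x.

(** A finite sum of rank-one kernels, equivalent to [psd_kernel] by [psd_kernel_gram] and
    [gram_psd]; in this form closure under pointwise products and pullbacks is immediate. *)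
Definition gram K :=
  exists vs : seq (T -> R), forall i j, K i j = \sum_(v <- vs) v i * v j.

Definition mass K : R := \sum_i \sum_j K i j.

Definition trace K : R := \sum_i K i i.

Definition indicator (a : T) : T -> R := fun i => (i == a)%:R.

Lemma sum_indicator (a : T) (F : T -> R) : \sum_i indicator a i * F i = F a.
Proof.
rewrite (bigD1 a) //= /indicator eqxx mul1r big1 ?addr0 // => i /negPf ->.
by rewrite mul0r.
Qed.

Lemma bform_sum K x y : bform K x y = \sum_i x i * \sum_j y j * K i j.
Proof.
by apply: eq_bigr => i _; rewrite big_distrr; apply: eq_bigr => j _ /=; rewrite mulrA.
Qed.

Lemma bform_indicator K a b : bform K (indicator a) (indicator b) = K a b.
Proof. by rewrite bform_sum !sum_indicator. Qed.

Lemma bform_indicatorl K a x : bform K (indicator a) x = \sum_j x j * K a j.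
Proof. by rewrite bform_sum sum_indicator. Qed.

Lemma bform_const1 K : bform K (fun=> 1) (fun=> 1) = mass K.
Proof. by apply: eq_bigr => i _; apply: eq_bigr => j _; rewrite !mul1r. Qed.

Lemma bform_lin K L c x :
  bform (fun i j => K i j + c * L i j) x x = bform K x x + c * bform L x x.
Proof.
rewrite /bform mulr_sumr -big_split; apply: eq_bigr => i _ /=.
by rewrite mulr_sumr -big_split; apply: eq_bigr => j _ /=; ring.
Qed.

Lemma bformC K x y : (forall i j, K i j = K j i) -> bform K x y = bform K y x.
Proof.
move=> Ksym; rewrite /bform exchange_big; apply: eq_bigr => i _.
by apply: eq_bigr => j _; rewrite Ksym; ring.
Qed.

Lemma bform_addZ K c x y : (forall i j, K i j = K j i) ->
  bform K (fun i => x i + c * y i) (fun i => x i + c * y i) =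
  bform K x x + 2 * c * bform K x y + c ^+ 2 * bform K y y.
Proof.
move=> Ksym; transitivity (bform K x x + c * bform K x y + c * bform K y x
    + c ^+ 2 * bform K y y); last by rewrite (bformC y x Ksym); ring.
rewrite /bform !mulr_sumr -!big_split; apply: eq_bigr => i _ /=.
by rewrite !mulr_sumr -!big_split; apply: eq_bigr => j _ /=; ring.
Qed.

Lemma bform_rank1 v x :
  bform (fun i j => v i * v j) x x = (\sum_i x i * v i) ^+ 2.
Proof.
rewrite expr2 big_distrl; apply: eq_bigr => i _ /=.
by rewrite big_distrr; apply: eq_bigr => j _ /=; ring.
Qed.

Lemma psd_kernel_rank1 v : psd_kernel (fun i j => v i * v j).
Proof. by split=> [i j|x]; [rewrite mulrC | rewrite bform_rank1 sqr_ge0]. Qed.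

Lemma psd_kernelD K L c : 0 <= c -> psd_kernel K -> psd_kernel L ->
  psd_kernel (fun i j => K i j + c * L i j).
Proof.
move=> c0 [Ks Kp] [Ls Lp]; split=> [i j|x]; first by rewrite Ks Ls.
by rewrite bform_lin addr_ge0 ?mulr_ge0.
Qed.

Lemma bform0 x : bform (fun _ _ => 0) x x = 0.
Proof. by rewrite /bform big1 // => i _; rewrite big1 // => j _; rewrite mulr0. Qed.

Lemma psd_kernel0 : psd_kernel (fun _ _ => 0).
Proof. by split=> // x; rewrite bform0. Qed.

Lemma psd_kernelZ K c : 0 <= c -> psd_kernel K -> psd_kernel (fun i j => c * K i j).
Proof.
move=> c0 [Ks Kp]; split=> [i j|x]; first by rewrite Ks.
rewrite (_ : bform _ x x = c * bform K x x); first exact: mulr_ge0.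
rewrite /bform mulr_sumr; apply: eq_bigr => i _.
by rewrite mulr_sumr; apply: eq_bigr => j _; rewrite mulrCA.
Qed.

Lemma psd_kernel_diag_ge0 K a : psd_kernel K -> 0 <= K a a.
Proof. by case=> _ /(_ (indicator a)); rewrite bform_indicator. Qed.

(** First-order condition at a minimum: dividing by [c] and letting [c] tend to 0 leaves [2 b]. The
    bound [c <= 1] serves the case where the minimum is tested along a segment. *)
Lemma slope_ge0 (a b : R) :
  (forall c, 0 < c -> c <= 1 -> 0 <= 2 * c * b + c ^+ 2 * a) -> 0 <= b.
Proof.
move=> h; rewrite leNgt; apply/negP => b0.
(* This choice gives [c * a <= - b], hence [2 * b + c * a <= b < 0]. *)
pose c := - b / (`|a| - b).
have a0 : 0 <= `|a| by [].
have d0 : 0 < `|a| - b by lra.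
have c0 : 0 < c by rewrite divr_gt0 // oppr_gt0.
have c1 : c <= 1 by rewrite ler_pdivrMr // mul1r; lra.
have := h _ c0 c1; rewrite leNgt => /negP; apply.
have -> : 2 * c * b + c ^+ 2 * a = c * (2 * b + c * a) by ring.
rewrite pmulr_rlt0 //.
have ca : c * a <= c * `|a| by rewrite ler_pM2l // ler_norm.
have : c * `|a| <= - b; last by lra.
rewrite mulrAC ler_pdivrMr // ler_pM2l ?oppr_gt0 //; lra.
Qed.

(** Otherwise the form at [indicator b + c * indicator a] would be a nonconstant affine function of
    [c], hence negative somewhere. *)
Lemma psd_kernel_row0 K a b : psd_kernel K -> K a a = 0 -> K a b = 0.
Proof.
move=> [Ks Kp] Kaa.
have h c : 0 <= K b b + 2 * c * K b a.
  have := Kp (fun i => indicator b i + c * indicator a i).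
  by rewrite bform_addZ // !bform_indicator Kaa mulr0 addr0.
apply/eqP; rewrite Ks -[_ == 0]negbK; apply/negP => n0.
have := h (- (K b b + 1) / (2 * K b a)).
have -> : K b b + 2 * (- (K b b + 1) / (2 * K b a)) * K b a = -1.
  by field; exact: n0.
by rewrite oppr_ge0 ler10.
Qed.

Lemma psd_kernel_le_diag K a b : psd_kernel K -> 2 * K a b <= K a a + K b b.
Proof.
move=> [Ks Kp]; have := Kp (fun i => indicator a i + (-1) * indicator b i).
rewrite bform_addZ // !bform_indicator; lra.
Qed.

Lemma psd_kernel_ge_diag K a b : psd_kernel K -> - (2 * K a b) <= K a a + K b b.
Proof.
move=> [Ks Kp]; have := Kp (fun i => indicator a i + 1 * indicator b i).
rewrite bform_addZ // !bform_indicator; lra.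
Qed.

(** Sum [2 * K a b <= K a a + K b b] over all pairs. This bounds the set whose supremum is theta. *)
Lemma mass_le_trace K : psd_kernel K -> mass K <= #|T|%:R * trace K.
Proof.
move=> psdK; rewrite -(ler_pM2l (ltr0Sn R 1)).
have -> : 2 * (#|T|%:R * trace K) = \sum_i \sum_j (K i i + K j j).
  under eq_bigr do rewrite big_split /= sumr_const.
  rewrite big_split /= sumr_const -/(trace K) sumrMnl -/(trace K) !mulr_natl.
  by rewrite mulr2n.
rewrite /mass mulr_sumr; apply: ler_sum => i _.
by rewrite mulr_sumr; apply: ler_sum => j _; exact: psd_kernel_le_diag.
Qed.

Lemma trace_ge0 K : psd_kernel K -> 0 <= trace K.
Proof. by move=> psdK; apply: sumr_ge0 => i _; exact: psd_kernel_diag_ge0. Qed.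

(* Each step subtracts the rank-one kernel that clears the row of a nonzero diagonal entry. *)
Lemma psd_kernel_gram K : psd_kernel K -> gram K.
Proof.
have [m] := ubnP #|[set i | K i i != 0]|.
elim: m K => // m IHm K; rewrite ltnS => leKm psdK.
have [K0|[a]] := set_0Vmem [set i | K i i != 0].
  exists [::] => i j; rewrite big_nil; apply: psd_kernel_row0 => //.
  by have /setP/(_ i) := K0; rewrite !inE => /negbFE/eqP.
rewrite inE => Kaa0.
have Kaa : 0 < K a a by rewrite lt_def Kaa0 psd_kernel_diag_ge0.
have [Ks Kp] := psdK.
pose w i := K a i / Num.sqrt (K a a).
have ww i j : w i * w j = K a i * K a j / K a a.
  by rewrite /w mulrACA -invfM -expr2 sqr_sqrtr // ltW.
pose L i j := K i j + (-1) * (w i * w j).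
have psdL : psd_kernel L.
  split=> [i j|x]; first by rewrite /L Ks [w i * _]mulrC.
  rewrite bform_lin bform_rank1.
  set s := \sum_i x i * K a i.
  have -> : (\sum_i x i * w i) ^+ 2 = s ^+ 2 / K a a.
    rewrite (_ : \sum_i _ = s / Num.sqrt (K a a)).
      by rewrite exprMn exprVn sqr_sqrtr // ltW.
    by rewrite mulr_suml; apply: eq_bigr => i _; rewrite mulrA.
  (* Completing the square: the form of [K] at this vector is the form of [L] at [x]. *)
  have := Kp (fun i => x i + (- s / K a a) * indicator a i).
  rewrite bform_addZ // bform_indicator (bformC _ _ Ks) bform_indicatorl -/s.
  suff -> : bform K x x + 2 * (- s / K a a) * s + (- s / K a a) ^+ 2 * K a a =
    bform K x x + -1 * (s ^+ 2 / K a a) by [].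
  by field.
have Laa : L a a = 0 by rewrite /L ww mulfK // mulN1r subrr.
case: (IHm L _ psdL) => [|vs Lvs].
  apply: leq_trans leKm; apply: proper_card; apply/properP; split.
    apply/fintype.subsetP => i; rewrite !inE; apply: contra => /eqP Kii.
    have Kai : K a i = 0 by rewrite Ks; exact: psd_kernel_row0.
    by rewrite /L ww Kai Kii !mul0r mulr0 addr0.
  by exists a; rewrite !inE ?Laa ?eqxx.
exists (w :: vs) => i j; rewrite big_cons -Lvs /L; ring.
Qed.

Lemma gram_sym K : gram K -> forall i j, K i j = K j i.
Proof.
by case=> vs Kvs i j; rewrite !Kvs; apply: eq_bigr => v _; rewrite mulrC.
Qed.

(** Self-duality of the positive semidefinite cone: each Gram vector [v] of [K] contributes
    [bform L v v]. *)
Lemma gram_inner_ge0 K L : gram K -> psd_kernel L ->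
  0 <= \sum_i \sum_j K i j * L i j.
Proof.
move=> [vs Kvs] [_ Lp].
rewrite (_ : \sum_i _ = \sum_(v <- vs) bform L v v); first exact: sumr_ge0.
rewrite /bform [RHS]exchange_big; apply: eq_bigr => i _ /=.
by rewrite [RHS]exchange_big; apply: eq_bigr => j _ /=; rewrite Kvs mulr_suml.
Qed.

Lemma gram_psd K : gram K -> psd_kernel K.
Proof.
move=> gK; split=> [|x]; first exact: gram_sym.
have := gram_inner_ge0 gK (psd_kernel_rank1 x).
suff -> : \sum_i \sum_j K i j * (x i * x j) = bform K x x by [].
by apply: eq_bigr => i _; apply: eq_bigr => j _; rewrite mulrC.
Qed.

Lemma eq_gram K L : (forall i j, K i j = L i j) -> gram K -> gram L.
Proof. by move=> KL [vs Kvs]; exists vs => i j; rewrite -KL. Qed.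

Lemma gramD K L : gram K -> gram L -> gram (fun i j => K i j + L i j).
Proof.
by move=> [vs Kvs] [ws Lws]; exists (vs ++ ws) => i j; rewrite big_cat Kvs Lws.
Qed.

(** Schur's product theorem: entrywise products of the Gram vectors of [K] and [L] are Gram vectors
    of the product. *)
Lemma gramM K L : gram K -> gram L -> gram (fun i j => K i j * L i j).
Proof.
move=> [vs Kvs] [ws Lws].
exists [seq (fun i => v i * w i) | v <- vs, w <- ws] => i j.
rewrite big_allpairs_dep Kvs Lws big_distrlr; apply: eq_bigr => v _.
by apply: eq_bigr => w _ /=; rewrite mulrACA.
Qed.

Lemma gram_const (c : R) : 0 <= c -> gram (fun _ _ => c).
Proof.
by move=> c0; exists [:: fun=> Num.sqrt c] => i j; rewrite big_seq1 -expr2 sqr_sqrtr.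
Qed.

Lemma gramZ K c : 0 <= c -> gram K -> gram (fun i j => c * K i j).
Proof. by move=> /gram_const /gramM h /h. Qed.

Lemma gram_square K : (forall i j, K i j = K j i) ->
  gram (fun i j => \sum_k K i k * K k j).
Proof.
move=> Ks; exists [seq K k | k <- enum T] => i j.
by rewrite big_map big_enum; apply: eq_bigr => k _; rewrite Ks.
Qed.

End Kernels.

Lemma gram_pullback (R : realType) (S T : finType) (f : S -> T) (K : T -> T -> R) :
  gram K -> gram (fun i j => K (f i) (f j)).
Proof.
by case=> vs Kvs; exists [seq v \o f | v <- vs] => i j; rewrite Kvs big_map.
Qed.

(** * The theta function and dual certificates *)

Section Theta.
Variables (R : realType) (T : finType).
Implicit Types (e : rel T) (K P : T -> T -> R) (t : R).

Definition feasible e K := psd_kernel K /\ forall x y, e x y -> K x y = 0.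

Definition certificate e t := exists P : T -> T -> R,
  [/\ forall x, P x x = t,
      forall x y, x != y -> ~~ e x y -> P x y = 0
    & gram (fun x y => P x y - 1)].

Lemma sum_enum_rank (F : 'I_#|T| -> R) : \sum_x F (enum_rank x) = \sum_i F i.
Proof.
rewrite [RHS](reindex (@enum_rank T)) //.
by apply: onW_bij; exact: enum_rank_bij.
Qed.

Lemma sum_enum_val (F : T -> R) : \sum_(i < #|T|) F (enum_val i) = \sum_x F x.
Proof. by rewrite -sum_enum_rank; apply: eq_bigr => x _; rewrite enum_rankK. Qed.

Lemma mxtrace_mul_const1 m (B : 'M[R]_m) :
  \tr (B *m const_mx 1) = \sum_i \sum_j B i j.
Proof.
by apply: eq_bigr => i _; rewrite mxE; apply: eq_bigr => j _; rewrite mxE mulr1.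
Qed.

Lemma quadratic_formE m (B : 'M[R]_m) (x : 'cV_m) :
  (x^T *m B *m x) 0 0 = \sum_i \sum_j x i 0 * x j 0 * B i j.
Proof.
rewrite exchange_big mxE; apply: eq_bigr => j _ /=; rewrite mxE mulr_suml.
by apply: eq_bigr => i _; rewrite !mxE; ring.
Qed.

(** Trades matrices indexed by ordinals for kernels on the vertices, along the enumeration of
    [T]. *)
Lemma lovasz_thetaE e : lovasz_theta R e =
  sup [set mass K | K in [set K | feasible e K /\ trace K = 1]]%classic.
Proof.
congr sup; apply/seteqP; split=> t [].
  move=> B [Bs Bp Bt Be] <-.
  exists (fun x y => B (enum_rank x) (enum_rank y)).
    split; last by rewrite -Bt /mxtrace -sum_enum_rank.
    split; last by move=> x y exy; apply: Be; rewrite !enum_rankK.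
    split=> [x y|x]; first by rewrite -[in LHS]Bs mxE.
    have := Bp (\col_i x (enum_val i)).
    rewrite quadratic_formE => /le_trans -> //; rewrite le_eqVlt.
    apply/predU1P; left; rewrite -sum_enum_rank; apply: eq_bigr => i _.
    rewrite -sum_enum_rank; apply: eq_bigr => j _.
    by rewrite !mxE !enum_rankK.
  rewrite mxtrace_mul_const1 /mass -sum_enum_rank; apply: eq_bigr => x _.
  by rewrite -sum_enum_rank.
move=> K [[[Ks Kp] Ke] Kt] <-.
exists (\matrix_(i, j) K (enum_val i) (enum_val j)).
  split.
  - by apply/matrixP => i j; rewrite !mxE Ks.
  - move=> x; rewrite quadratic_formE; have := Kp (fun a => x (enum_rank a) 0).
    move=> /le_trans -> //; rewrite le_eqVlt; apply/predU1P; left.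
    rewrite /bform -sum_enum_val; apply: eq_bigr => i _.
    rewrite -sum_enum_val; apply: eq_bigr => j _.
    by rewrite !mxE !enum_valK.
  - by rewrite -Kt /trace -sum_enum_val; apply: eq_bigr => i _; rewrite mxE.
  - by move=> i j /Ke; rewrite mxE.
rewrite mxtrace_mul_const1 /mass -sum_enum_val; apply: eq_bigr => i _.
by rewrite -sum_enum_val; apply: eq_bigr => j _; rewrite mxE.
Qed.

(** Rescaling to trace 1 reduces this to the supremum; for trace 0, [mass_le_trace] already gives
    [mass K <= 0]. *)
Lemma mass_le_theta e K : feasible e K -> mass K <= lovasz_theta R e * trace K.
Proof.
move=> [psdK Ke]; have := trace_ge0 psdK; rewrite le_eqVlt => /predU1P[K0|K0].
  by have := mass_le_trace psdK; rewrite -K0 !mulr0.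
have c0 : 0 <= (trace K)^-1 by rewrite invr_ge0 ltW.
rewrite -ler_pdivrMr // lovasz_thetaE; apply: ub_le_sup.
  exists #|T|%:R => _ [L [[psdL _] Lt] <-].
  by have := mass_le_trace psdL; rewrite Lt mulr1.
exists (fun x y => (trace K)^-1 * K x y).
  split; first split; first exact: psd_kernelZ.
    by move=> x y /Ke ->; rewrite mulr0.
  by rewrite /trace -mulr_sumr mulVf // gt_eqF.
rewrite /mass; under eq_bigr do rewrite -mulr_sumr.
by rewrite -mulr_sumr mulrC.
Qed.

Hypothesis T_gt0 : (0 < #|T|)%N.

Lemma lovasz_theta_le e t : irreflexive e ->
  (forall K, feasible e K -> mass K <= t * trace K) -> lovasz_theta R e <= t.
Proof.
move=> eirr h; rewrite lovasz_thetaE; apply: ge_sup; last first.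
  by move=> _ [K [fK Kt] <-]; rewrite -[t]mulr1 -Kt; exact: h.
(* The supremum must range over a nonempty set: a kernel concentrated on one diagonal entry is
   feasible because [e] has no loops. *)
have /card_gt0P[a _] := T_gt0.
pose K (x y : T) : R := indicator R a x * indicator R a y.
exists (mass K), K => //; split; last by rewrite /trace sum_indicator /indicator eqxx.
split; first exact: psd_kernel_rank1.
move=> x y; rewrite /K /indicator; have [->|_] := eqVneq x a; last by rewrite mul0r.
by have [->|_] := eqVneq y a; rewrite ?eirr ?mulr0.
Qed.

(** Weak duality: pair [P - 1] with [K]. Off the diagonal [P] or [K] vanishes, so [P] contributes
    just [t * trace K]. *)
Lemma certificate_mass_le e t K :
  certificate e t -> feasible e K -> mass K <= t * trace K.
Proof.
move=> [P [Pd P0 Pg]] [psdK Ke]; have := gram_inner_ge0 Pg psdK.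
suff -> : \sum_i \sum_j (P i j - 1) * K i j = t * trace K - mass K by rewrite subr_ge0.
rewrite mulr_sumr -sumrB; apply: eq_bigr => i _.
under eq_bigr do rewrite mulrBl mul1r.
rewrite sumrB; congr (_ - _); rewrite (bigD1 i) //= Pd big1 ?addr0 // => j ji.
have [/Ke ->|neij] := boolP (e i j); first by rewrite mulr0.
by rewrite P0 ?mul0r // eq_sym.
Qed.

Lemma certificate_theta_le e t :
  irreflexive e -> certificate e t -> lovasz_theta R e <= t.
Proof.
by move=> eirr ct; apply: lovasz_theta_le => // K; exact: certificate_mass_le.
Qed.

Lemma certificate_ge1 e t : certificate e t -> 1 <= t.
Proof.
move=> [P [Pd _ Pg]]; have /card_gt0P[a _] := T_gt0.
by have := psd_kernel_diag_ge0 a (gram_psd Pg); rewrite Pd subr_ge0.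
Qed.

(** With [n = #|T|], such a [P] is feasible for [e] and has trace [n * t]; testing [P - 1] on the
    all-ones vector shows that its mass is at least [n ^ 2]. *)
Lemma certificate_compl_theta_ge e t : irreflexive e ->
  certificate (compl_graph e) t -> #|T|%:R <= t * lovasz_theta R e.
Proof.
move=> eirr [P [Pd P0 Pg]].
have fP : feasible e P.
  split.
    apply/gram_psd/(eq_gram _ (gramD Pg (gram_const T ler01))) => i j.
    by rewrite subrK.
  move=> x y exy; apply: P0; first by apply: contraTneq exy => ->; rewrite eirr.
  by rewrite /compl_graph exy andbF.
have n0 : 0 < #|T|%:R :> R by rewrite ltr0n.
rewrite -(ler_pM2l n0); have := mass_le_theta fP.
have -> : trace P = #|T|%:R * t.
  by rewrite /trace; under eq_bigr do rewrite Pd; rewrite sumr_const mulr_natl.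
rewrite mulrCA [t * _]mulrC; apply: le_trans; rewrite -subr_ge0.
have := (gram_psd Pg).2 (fun=> 1); rewrite bform_const1.
suff -> : mass (fun x y => P x y - 1) = mass P - #|T|%:R * #|T|%:R by [].
rewrite /mass; under eq_bigr do rewrite sumrB sumr_const.
by rewrite sumrB sumr_const mulr_natr.
Qed.

End Theta.

(** * Certificates under pullbacks and strong products *)

Lemma certificate_pullback (R : realType) (S T : finType) (f : S -> T)
    (e : rel S) (e' : rel T) (t : R) : injective f ->
  (forall x y, ~~ e x y -> ~~ e' (f x) (f y)) ->
  certificate e' t -> certificate e t.
Proof.
move=> finj h [P [Pd P0 Pg]]; exists (fun x y => P (f x) (f y)); split.
- by move=> x.
- by move=> x y xy /h; apply: P0; rewrite inj_eq.
- exact: (gram_pullback f Pg).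
Qed.

Section Tensor.
Variables (R : realType).

(* [P Q - 1 = (P - 1) (Q - 1) + (P - 1) + (Q - 1)] *)
Lemma gram_prod_sub1 (S I : finType) (P : I -> S -> S -> R) (r : seq I) :
  (forall i, gram (fun x y => P i x y - 1)) ->
  gram (fun x y => \prod_(i <- r) P i x y - 1).
Proof.
move=> Pg; elim: r => [|i r IHr].
  by apply: eq_gram (gram_const S (lexx 0)) => x y; rewrite big_nil subrr.
apply: eq_gram (gramD (gramM (Pg i) IHr) (gramD (Pg i) IHr)) => x y.
by rewrite big_cons; ring.
Qed.

(** A distinct nonadjacent pair of the product is distinct and nonadjacent in some coordinate, and
    the factor of that coordinate vanishes. *)
Lemma certificate_strong_prod (T1 T2 : finType) (e1 : rel T1) (e2 : rel T2) (t1 t2 : R) :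
  certificate e1 t1 -> certificate e2 t2 -> certificate (strong_prod e1 e2) (t1 * t2).
Proof.
move=> [P [Pd P0 Pg]] [Q [Qd Q0 Qg]].
exists (fun x y => P x.1 y.1 * Q x.2 y.2); split.
- by move=> x; rewrite Pd Qd.
- move=> x y xy; rewrite /strong_prod xy /= negb_and !negb_or.
  by case/orP=> /andP[n ne]; rewrite ?(P0 _ _ n ne) ?(Q0 _ _ n ne) ?mul0r ?mulr0.
- have h := gram_pullback (fst : T1 * T2 -> T1) Pg.
  have h' := gram_pullback (snd : T1 * T2 -> T2) Qg.
  by apply: eq_gram (gramD (gramM h h') (gramD h h')) => x y; ring.
Qed.

Lemma certificate_strong_pow (T : finType) (e : rel T) (t : R) k :
  certificate e t -> certificate (strong_pow e k) (t ^+ k).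
Proof.
move=> [P [Pd P0 Pg]].
exists (fun f g : {ffun 'I_k -> T} => \prod_(i < k) P (f i) (g i)); split.
- by move=> f; under eq_bigr do rewrite Pd; rewrite prodr_const card_ord.
- move=> f g fg; rewrite /strong_pow fg /= negb_forall => /existsP[i].
  by rewrite negb_or => /andP[n ne]; rewrite (bigD1 i) //= P0 // mul0r.
- apply: (@gram_prod_sub1 _ _ (fun i (f g : {ffun 'I_k -> T}) => P (f i) (g i))).
  by move=> i; exact: (gram_pullback (fun f : {ffun 'I_k -> T} => f i) Pg).
Qed.

End Tensor.

(** * Independence number against theta and certificates *)

Section Independence.
Variable (T : finType).
Implicit Types (e : rel T) (S : {set T}).

Lemma alpha_attained e : exists2 S, independent e S & #|S| = alpha e.
Proof.
have [|S iS eS] := @eq_bigmax_cond _ (independent e) (fun S => #|S|).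
  apply/card_gt0P; exists finset.set0; apply/forallP => x; apply/implyP.
  by rewrite finset.in_set0.
by exists S.
Qed.

Lemma leq_alpha e S : independent e S -> (#|S| <= alpha e)%N.
Proof. exact: (leq_bigmax_cond (F := fun S => #|S|)). Qed.

Lemma independentP e S :
  reflect (forall x y, x \in S -> y \in S -> ~~ e x y) (independent e S).
Proof.
apply: (iffP forall_inP) => h x; first by move=> y /h /forall_inP; exact.
by move=> xS; apply/forall_inP => y; exact: h.
Qed.

Lemma alpha_gt0 e : irreflexive e -> (0 < #|T|)%N -> (0 < alpha e)%N.
Proof.
move=> eirr /card_gt0P[a _]; rewrite -(cards1 a); apply: leq_alpha.
by apply/independentP => x y /finset.set1P -> /finset.set1P ->; rewrite eirr.
Qed.

(** The witness is the rank-one kernel of the indicator vector of a maximum independent set; its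
    ratio of mass to trace is [alpha e]. *)
Lemma feasible_alpha (R : realType) e : exists K : T -> T -> R,
  [/\ feasible e K, mass K = (alpha e)%:R * (alpha e)%:R & trace K = (alpha e)%:R].
Proof.
have [S iS <-] := alpha_attained e.
pose v x : R := (x \in S)%:R; exists (fun x y => v x * v y).
have vS : \sum_x v x = #|S|%:R.
  rewrite -sum1_card natr_sum [RHS]big_mkcond; apply: eq_bigr => x _.
  by rewrite /v; case: (x \in S).
split.
- split=> [|x y exy]; first exact: psd_kernel_rank1.
  rewrite /v; have [xS|_] := boolP (x \in S); last by rewrite mul0r.
  have [yS|_] := boolP (y \in S); last by rewrite mulr0.
  by have /independentP/(_ x y xS yS) := iS; rewrite exy.
- rewrite /mass; under eq_bigr do rewrite -mulr_sumr vS.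
  by rewrite -mulr_suml vS.
- rewrite -vS; apply: eq_bigr => x _.
  by rewrite /v; case: (x \in S); rewrite ?mulr1 ?mulr0.
Qed.

Lemma alpha_le_theta (R : realType) e : (0 < alpha e)%N ->
  (alpha e)%:R <= lovasz_theta R e.
Proof.
have [K [fK mK tK]] := feasible_alpha R e; move=> a0.
by have := mass_le_theta fK; rewrite mK tK ler_pM2r // ltr0n.
Qed.

Lemma certificate_alpha_le (R : realType) e (t : R) :
  0 <= t -> certificate e t -> (alpha e)%:R <= t.
Proof.
have [K [fK mK tK]] := feasible_alpha R e; move=> t0 ct.
have [->//|a0] := posnP (alpha e).
by have := certificate_mass_le ct fK; rewrite mK tK ler_pM2r // ltr0n.
Qed.

End Independence.

(** * Shannon capacity and Ramsey's bound *)

Lemma leq_alpha_map (S T : finType) (e : rel S) (e' : rel T) (f : S -> T) :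
  injective f -> (forall x y, e' (f x) (f y) -> e x y) ->
  (alpha e <= alpha e')%N.
Proof.
move=> finj h; have [A /independentP iA <-] := alpha_attained e.
rewrite -(card_imset _ finj); apply: leq_alpha; apply/independentP => u w.
move=> /imsetP[x xA ->] /imsetP[y yA ->]; apply: contra (iA x y xA yA).
exact: h.
Qed.

Lemma alpha_le_card (T : finType) (e : rel T) : (alpha e <= #|T|)%N.
Proof. by have [A _ <-] := alpha_attained e; exact: max_card. Qed.

Lemma alpha_strong_pow1 (T : finType) (e : rel T) :
  (alpha e <= alpha (strong_pow e 1))%N.
Proof.
apply: (@leq_alpha_map _ _ _ _ (fun x => [ffun=> x])) => [x y /ffunP/(_ ord0)|x y].
  by rewrite !ffunE.
rewrite /strong_pow => /andP[n /forallP/(_ ord0)]; rewrite !ffunE.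
by case/predU1P => // xy; rewrite xy eqxx in n.
Qed.

Lemma alpha_strong_pow2 (T : finType) (e : rel T) :
  (alpha (strong_prod e e) <= alpha (strong_pow e 2))%N.
Proof.
pose f (x : T * T) : {ffun 'I_2 -> T} := [ffun i => if i == ord0 then x.1 else x.2].
have f0 x : f x ord0 = x.1 by rewrite ffunE.
have f1 x : f x (lift ord0 ord0) = x.2 by rewrite ffunE.
have finj : injective f.
  by move=> x y fxy; apply/eqP; rewrite /eq_op /= -!f0 -!f1 fxy !eqxx.
apply: (leq_alpha_map finj) => x y; rewrite /strong_pow /strong_prod inj_eq //.
move=> /andP[-> /forallP h] /=.
by have := h ord0; rewrite !f0 => ->; have := h (lift ord0 ord0); rewrite !f1 => ->.
Qed.

Section Shannon.
Variables (R : realType) (T : finType) (e : rel T).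

Lemma powR_root (t : R) k : (0 < k)%N -> 0 <= t -> powR (t ^+ k) k%:R^-1 = t.
Proof.
by move=> k0 t0; rewrite -powR_mulrn // -powRrM mulfV ?powRr1 // pnatr_eq0 -lt0n.
Qed.

Lemma powR_root_le (a t : R) k : (0 < k)%N -> 0 <= a -> 0 <= t -> a <= t ^+ k ->
  powR a k%:R^-1 <= t.
Proof.
move=> k0 a0 t0 at_k; rewrite -[leRHS](powR_root k0 t0).
by apply: ge0_ler_powR => //; rewrite ?invr_ge0 // nnegrE exprn_ge0.
Qed.

Lemma shannon_capacity_le (t : R) : 0 <= t ->
  (forall k, (alpha (strong_pow e k))%:R <= t ^+ k) -> shannon_capacity R e <= t.
Proof.
move=> t0 h; apply: ge_sup; first by exists (powR (alpha (strong_pow e 1))%:R 1%:R^-1), 1%N.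
by move=> _ [k k1 <-]; exact: powR_root_le.
Qed.

Lemma alpha_strong_pow_le k : ((alpha (strong_pow e k))%:R <= #|T|%:R ^+ k :> R).
Proof.
rewrite -natrX ler_nat; apply: leq_trans (alpha_le_card _) _.
by rewrite card_ffun card_ord.
Qed.

Lemma shannon_capacity_le_card : shannon_capacity R e <= #|T|%:R.
Proof. by apply: shannon_capacity_le => // k; exact: alpha_strong_pow_le. Qed.

Lemma shannon_capacity_ge k : (0 < k)%N ->
  powR (alpha (strong_pow e k))%:R k%:R^-1 <= shannon_capacity R e.
Proof.
move=> k0; apply: ub_le_sup; last by exists k.
exists #|T|%:R => _ [j j0 <-]; apply: powR_root_le => //.
exact: alpha_strong_pow_le.
Qed.

Lemma alpha_le_shannon : (alpha e)%:R <= shannon_capacity R e.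
Proof.
apply: le_trans (shannon_capacity_ge (ltnSn 0)).
by rewrite invr1 powRr1 // ler_nat alpha_strong_pow1.
Qed.

Lemma sqrt_alpha_le_shannon :
  Num.sqrt (alpha (strong_prod e e))%:R <= shannon_capacity R e.
Proof.
apply: le_trans (shannon_capacity_ge (ltn0Sn 1)).
by rewrite powR12_sqrt // ler_sqrt // ler_nat alpha_strong_pow2.
Qed.

Lemma certificate_shannon_le (t : R) :
  0 <= t -> certificate e t -> shannon_capacity R e <= t.
Proof.
move=> t0 ct; apply: shannon_capacity_le => // k.
by apply: certificate_alpha_le; [exact: exprn_ge0 | exact: certificate_strong_pow].
Qed.

End Shannon.

(** * Diagonal independent sets and Ramsey's bound *)

Section Diagonal.
Variables (T : finType) (e : rel T).

(** The diagonal is independent: distinct vertices are adjacent in only one of the graph and its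
    complement. *)
Lemma alpha_diagonal : irreflexive e ->
  (#|T| <= alpha (strong_prod e (compl_graph e)))%N.
Proof.
move=> eirr; have dinj : injective (fun x : T => (x, x)) by move=> x y [].
rewrite -cardsT -(card_imset _ dinj); apply: leq_alpha; apply/independentP.
move=> u w /imsetP[x _ ->] /imsetP[y _ ->]; rewrite /strong_prod /compl_graph /=.
by rewrite xpair_eqE andbb; case: eqVneq => //= _; rewrite andbN.
Qed.

(** The twisted diagonal of pairs [(x, s x)] is independent, because [s] sends edges to nonedges. *)
Lemma alpha_self_complementary : self_complementary e ->
  (#|T| <= alpha (strong_prod e e))%N.
Proof.
move=> [s es]; have dinj : injective (fun x : T => (x, s x)) by move=> x y [].
rewrite -cardsT -(card_imset _ dinj); apply: leq_alpha; apply/independentP.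
move=> u w /imsetP[x _ ->] /imsetP[y _ ->]; rewrite /strong_prod /=.
rewrite xpair_eqE (inj_eq perm_inj) andbb; case: eqVneq => //= xy; rewrite -es /compl_graph.
by rewrite (inj_eq perm_inj) xy /= andNb.
Qed.

(** Erdos-Szekeres recursion: remove a vertex [v] of [A] and split the rest into neighbours [N] and
    non-neighbours [M]. One part is large enough for the induction, and [v] extends a clique found
    in [N] or an independent set found in [M]. *)
Lemma ramsey_pow2 a b (A : {set T}) : symmetric e -> irreflexive e ->
  (2 ^ (a + b) <= #|A|)%N ->
  (exists S : {set T}, [/\ S \subset A, independent e S & (a <= #|S|)%N]) \/
  (exists S : {set T}, [/\ S \subset A, independent (compl_graph e) S & (b <= #|S|)%N]).
Proof.
move=> esym eirr; have [m] := ubnP (a + b).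
have ind0 e' : independent e' finset.set0.
  by apply/independentP => x y; rewrite finset.in_set0.
have ext e' v (B S : {set T}) : symmetric e' -> irreflexive e' -> v \in B ->
    (forall x, x \in S -> ~~ e' v x) -> independent e' S ->
    independent e' (v |: S).
  move=> e's e'i vB vS /independentP iS; apply/independentP => x y.
  case/setU1P => [->|xS] /setU1P[->|yS]; first by rewrite e'i.
  - exact: vS.
  - by rewrite e's vS.
  - exact: iS.
elim: m a b A => // m IHm [|a] [|b] A; rewrite ltnS => lem leA.
- by left; exists finset.set0; split=> //; exact: finset.sub0set.
- by left; exists finset.set0; split=> //; exact: finset.sub0set.
- by right; exists finset.set0; split=> //; exact: finset.sub0set.
have /card_gt0P[v vA] : (0 < #|A|)%N by apply: leq_trans leA; rewrite expn_gt0.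
pose N := [set x in A :\ v | e v x]; pose M := [set x in A :\ v | ~~ e v x].
have NM : (#|A| = (#|N| + #|M|).+1)%N.
  rewrite (cardsD1 v A) vA; congr _.+1.
  by rewrite -(cardsID [set x | e v x] (A :\ v)); congr addn;
    apply: eq_card => x; rewrite !inE; case: (e v x); rewrite ?andbT ?andbF.
have NA : N \subset A by apply/fintype.subsetP => x; rewrite !inE -andbA => /and3P[].
have MA : M \subset A by apply/fintype.subsetP => x; rewrite !inE -andbA => /and3P[].
have vN : v \notin N by rewrite !inE eqxx.
have vM : v \notin M by rewrite !inE eqxx.
have [leM|ltM] := leqP (2 ^ (a + b.+1)) #|M|.
  have lem' : (a + b.+1 < m)%N by rewrite -addSn.
  have [[S [SM iS aS]]|[S [SM iS bS]]] := IHm a b.+1 M lem' leM.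
  - left; exists (v |: S); split.
    + by rewrite finset.subUset finset.sub1set vA (fintype.subset_trans SM).
    + apply: (ext e v A) => // x xS.
      by have := fintype.subsetP SM x xS; rewrite !inE => /andP[].
    + by rewrite cardsU1 (contra (fintype.subsetP SM v) vM) add1n.
  - by right; exists S; split=> //; exact: fintype.subset_trans SM MA.
(* The removed vertex costs one, which the strict inequality [ltM] gives back. *)
have leN : (2 ^ (a.+1 + b) <= #|N|)%N.
  move: leA; rewrite NM addSn expnS mul2n -addnn -addnS => leA.
  rewrite addSnnS; lia.
have lem' : (a.+1 + b < m)%N by rewrite -addnS.
have [[S [SN iS aS]]|[S [SN iS bS]]] := IHm a.+1 b N lem' leN.
- by left; exists S; split=> //; exact: fintype.subset_trans SN NA.
- right; exists (v |: S); split.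
  + by rewrite finset.subUset finset.sub1set vA (fintype.subset_trans SN).
  + apply: (ext (compl_graph e) v A) => //.
    * by move=> x y; rewrite /compl_graph eq_sym esym.
    * by move=> x; rewrite /compl_graph eqxx.
    * move=> x xS; have := fintype.subsetP SN x xS; rewrite !inE => /andP[_ evx].
      by rewrite /compl_graph evx andbF.
  + by rewrite cardsU1 (contra (fintype.subsetP SN v) vN) add1n.
Qed.

(** Ramsey with [a = b = (alpha e).+1]: since [s] maps cliques to independent sets, either outcome
    yields an independent set that is too large. *)
Lemma self_complementary_card_le : symmetric e -> irreflexive e ->
  self_complementary e -> (#|T| <= 4 ^ (alpha e).+1)%N.
Proof.
move=> esym eirr [s es]; rewrite leqNgt; apply/negP => /ltnW.
rewrite (_ : 4 = 2 ^ 2)%N // -expnM mul2n -addnn -cardsT.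
case/(ramsey_pow2 esym eirr) => [] [S [_ iS]]; first by rewrite ltnNge leq_alpha.
rewrite -(card_imset S (@perm_inj _ s)) ltnNge leq_alpha //.
apply/independentP => u w /imsetP[x xS ->] /imsetP[y yS ->].
apply/negP => sxy; have /independentP/(_ x y xS yS)/negP := iS; apply.
have xy : x != y by apply: contraTneq sxy => ->; rewrite eirr.
rewrite /compl_graph xy -es; apply: contraL sxy.
by rewrite /compl_graph => /andP[].
Qed.

End Diagonal.

(** * Strongly regular graphs *)

(** Such a [K] is [c] times an orthogonal projection, so it is [c^-1] times the square of a
    symmetric kernel. *)
Lemma gram_of_square (R : realType) (T : finType) (K : T -> T -> R) c : 0 < c ->
  (forall i j, K i j = K j i) ->
  (forall i j, \sum_k K i k * K k j = c * K i j) -> gram K.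
Proof.
move=> c0 Ks K2; have c0' : 0 <= c^-1 by rewrite invr_ge0 ltW.
apply: eq_gram (gramZ c0' (gram_square Ks)) => i j.
by rewrite K2 mulKf // gt_eqF.
Qed.

Section StronglyRegular.
Variables (R : realType) (T : finType) (e : rel T) (d l m : nat).
Hypothesis esym : symmetric e.
Hypothesis eirr : irreflexive e.
Hypothesis srg : srg_params e d l m.

Local Notation n := (#|T|%:R : R).

Let a (x y : T) : R := (e x y)%:R.
Let I (x y : T) : R := (x == y)%:R.

Let aC x y : a x y = a y x. Proof. by rewrite /a esym. Qed.
Let IC x y : I x y = I y x. Proof. by rewrite /I eq_sym. Qed.

(* [srg_params] counts neighbourhoods as classical sets. *)
Let sum_bool (P : pred T) : \sum_z (P z)%:R = #|[set z | P z]%classic|%:R :> R.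
Proof.
rewrite -sum1_card natr_sum [RHS]big_mkcond; apply: eq_bigr => z _.
suff -> : (z \in in_set [set w | P w]%classic) = P z by case: (P z).
exact: asboolb.
Qed.

Let sum_a x : \sum_z a x z = d%:R.
Proof. by have [dE _ _ _ _] := srg; rewrite -(dE x) -sum_bool. Qed.

Let sum_I x (F : T -> R) : \sum_z I x z * F z = F x.
Proof.
rewrite (bigD1 x) //= big1 ?addr0; first by rewrite /I eqxx mul1r.
by move=> z zx; rewrite /I eq_sym (negPf zx) mul0r.
Qed.

Let a_square x y :
  \sum_z a x z * a z y = d%:R * I x y + l%:R * a x y + m%:R * (1 - I x y - a x y).
Proof.
have [dE _ _ lE mE] := srg.
have -> : \sum_z a x z * a z y = #|[set z | e x z && e y z]%classic|%:R.
  rewrite -sum_bool; apply: eq_bigr => z _.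
  by rewrite /a [e z y]esym; case: (e x z); rewrite ?mul1r ?mul0r.
rewrite /a /I; have [<-|xy] := eqVneq x y.
  rewrite eirr -(dE x); under eq_fun do rewrite andbb.
  by rewrite /=; ring.
have [exy|exy] := boolP (e x y); first by rewrite lE //=; ring.
by rewrite mE //=; ring.
Qed.

(** Sum [a_square] over [y]: both sides count the walks of length two from a fixed vertex. *)
Let srg_count : d%:R * d%:R = d%:R + l%:R * d%:R + m%:R * (n - 1 - d%:R) :> R.
Proof.
have [_ [x _] _ _ _] := srg.
transitivity (\sum_y \sum_z a x z * a z y).
  rewrite exchange_big /= -{1}(sum_a x) mulr_suml; apply: eq_bigr => z _.
  by rewrite -mulr_sumr sum_a.
under eq_bigr do rewrite a_square.
rewrite !big_split /= -!mulr_sumr !sumrB !sum_a sumr_const.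
have -> : \sum_y I x y = 1 by rewrite -[RHS](sum_I x (fun=> 1)); apply: eq_bigr => y; rewrite mulr1.
by rewrite mulr1.
Qed.

Let n_gt0 : 0 < n.
Proof. by have [_ [x _] _ _ _] := srg; rewrite ltr0n; apply/card_gt0P; exists x. Qed.

(** If [r] and [s] are the adjacency eigenvalues on vectors orthogonal to the constants, this kernel
    kills the constants and the [s]-eigenspace, so it is [r - s] times the projection on the
    [r]-eigenspace. *)
Let root_kernel (s : R) x y : R := a x y - s * I x y - (d%:R - s) / n.

Let root_kernelC s x y : root_kernel s x y = root_kernel s y x.
Proof. by rewrite /root_kernel aC IC. Qed.

Let root_kernel_square (r s : R) : r + s = l%:R - m%:R -> r * s = m%:R - d%:R ->
  forall x y, \sum_z root_kernel s x z * root_kernel s z y = (r - s) * root_kernel s x y.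
Proof.
move=> rs_add rs_mul x y; pose c := (d%:R - s) / n.
(* The product is expanded so that each sum over [z] has a known value; the last two sums both equal
   1 and cancel. *)
transitivity (\sum_z a x z * a z y + - s * (\sum_z I y z * a x z) + - c * (\sum_z a x z)
  + - s * (\sum_z I x z * a z y) + s ^+ 2 * (\sum_z I x z * I z y)
  + 2 * s * c * (\sum_z I x z * 1)
  + - c * (\sum_z a y z) + c ^+ 2 * (\sum_(z : T) 1)
  + s * c * (\sum_z I y z * 1 - \sum_z I x z * 1)).
  rewrite mulrBr !mulr_sumr -sumrB -!big_split; apply: eq_bigr => z _ /=.
  by rewrite /root_kernel -/c (IC z y) (aC z y); ring.
have cn : c * n = d%:R - s by rewrite divfK ?gt_eqF.
(* Equivalent to [(d - r) * (d - s) = m * n], a form of [srg_count]. *)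
have cr : c * (d%:R - r) = m%:R.
  apply: (mulIf (lt0r_neq0 n_gt0)); rewrite mulrAC cn.
  transitivity (d%:R * d%:R - (r + s) * d%:R + r * s); first by ring.
  by rewrite rs_add rs_mul srg_count; ring.
rewrite a_square !sum_I !sum_a sumr_const subrr mulr0 addr0.
rewrite /root_kernel -/c.
apply/eqP; rewrite -subr_eq0; apply/eqP; transitivity
  ((l%:R - m%:R - (r + s)) * a x y + (r * s - (m%:R - d%:R)) * I x y
    + (m%:R - c * (d%:R - r)) + c * (c * n - (d%:R - s))); first by ring.
by rewrite cr cn rs_add rs_mul !subrr !mulr0 !mul0r !addr0.
Qed.

Let le_md : (m <= d)%N.
Proof.
have [dE [x [y /andP[xy nexy]]] _ _ mE] := srg.
rewrite -(mE x y) // -(dE x); apply/subset_leq_card/fintype.subsetP => z.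
by rewrite !in_setE => /andP[].
Qed.

Let lt_ld : (l < d)%N.
Proof.
have [dE _ [x [y exy]] lE _] := srg.
rewrite -(lE x y) // -(dE x); apply/proper_card/properP; split.
  by apply/fintype.subsetP => z; rewrite !in_setE => /andP[].
exists y; first by rewrite in_setE.
by apply/negP; rewrite in_setE /= eirr andbF.
Qed.

Let lt_dn : (d < #|T|)%N.
Proof.
have [dE _ [x _] _ _] := srg; rewrite -(dE x) -cardsT.
apply/proper_card/properP; split; first by apply/fintype.subsetP.
by exists x => //; apply/negP; rewrite in_setE /= eirr.
Qed.

(** The roots of [X ^ 2 - (l - m) * X - (d - m)]. Here [m <= d] gives [0 <= r], and [l < d] keeps
    [s] away from 0. *)
Lemma srg_eigenvalues : exists r s : R,
  [/\ r + s = l%:R - m%:R, r * s = m%:R - d%:R, s < 0 & 0 <= r].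
Proof.
pose p : R := l%:R - m%:R; pose q : R := d%:R - m%:R.
have q0 : 0 <= q by rewrite subr_ge0 ler_nat.
have pq : p < q by rewrite ltrD2r ltr_nat.
pose D := Num.sqrt (p ^+ 2 + 4 * q).
have D0 : 0 <= D by exact: sqrtr_ge0.
have D2 : D ^+ 2 = p ^+ 2 + 4 * q by rewrite sqr_sqrtr //; have := sqr_ge0 p; lra.
exists ((p + D) / 2), ((p - D) / 2); split.
- by rewrite -/p; field.
- transitivity ((p ^+ 2 - D ^+ 2) / 4); first by field.
  by rewrite D2 /q; field.
- suff : p < D by lra.
  have [p0|p0] := ltrP p 0; first by exact: lt_le_trans p0 D0.
  by rewrite -(ltr_pXn2r (n := 2)) // D2; lra.
- suff : - p <= D by lra.
  have [p0|p0] := lerP 0 p; first by lra.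
  by rewrite -(ler_pXn2r (n := 2)) ?nnegrE //; [rewrite D2 sqrrN; lra | lra].
Qed.

Variables r s : R.
Hypothesis rs_add : r + s = l%:R - m%:R.
Hypothesis rs_mul : r * s = m%:R - d%:R.
Hypothesis s_lt0 : s < 0.
Hypothesis r_ge0 : 0 <= r.

Let ds_gt0 : 0 < d%:R - s.
Proof. by rewrite subr_gt0 (lt_le_trans s_lt0). Qed.

Let ndr_gt0 : 0 < n - d%:R + r.
Proof. by rewrite ltr_wpDr // subr_gt0 ltr_nat. Qed.

Let rs_gt0 : 0 < r - s. Proof. by rewrite subr_gt0 (lt_le_trans s_lt0). Qed.

(** On distinct nonadjacent pairs [root_kernel s] equals [- (d - s) / n]; the scaling turns this
    into -1, which the added 1 cancels. *)
Lemma srg_certificate : certificate e (- s * n / (d%:R - s)).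
Proof.
have c0 : 0 <= n / (d%:R - s) by rewrite divr_ge0 // ltW.
have nn0 := lt0r_neq0 n_gt0; have ds0 := lt0r_neq0 ds_gt0.
exists (fun x y => n / (d%:R - s) * root_kernel s x y + 1); split.
- by move=> x; rewrite /root_kernel /a /I eqxx eirr /=; field; rewrite nn0 ds0.
- move=> x y /negPf xy /negPf exy; rewrite /root_kernel /a /I xy exy /=.
  by field; rewrite nn0 ds0.
- have gK := gram_of_square rs_gt0 (root_kernelC s) (root_kernel_square rs_add rs_mul).
  by apply: eq_gram (gramZ c0 gK) => x y; rewrite addrK.
Qed.

(** The same construction from the other eigenvalue: exchanging [r] and [s] makes the square a
    negative multiple of the kernel, hence the sign change. The scaling now normalizes the entries
    on edges of [e]. *)
Lemma srg_certificate_compl :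
  certificate (compl_graph e) (n * (1 + r) / (n - d%:R + r)).
Proof.
have c0 : 0 <= n / (n - d%:R + r) by rewrite divr_ge0 // ltW.
have nn0 := lt0r_neq0 n_gt0; have ds0 := lt0r_neq0 ndr_gt0.
exists (fun x y => n / (n - d%:R + r) * - root_kernel r x y + 1); split.
- by move=> x; rewrite /root_kernel /a /I eqxx eirr /=; field; rewrite nn0 ds0.
- move=> x y xy; rewrite /compl_graph xy negbK /= => exy.
  by rewrite /root_kernel /a /I (negPf xy) exy /= mulr1n; field; rewrite nn0 ds0.
- have gK : gram (fun x y => - root_kernel r x y).
    apply: (gram_of_square rs_gt0) => x y; first by rewrite root_kernelC.
    under eq_bigr do rewrite mulrNN.
    rewrite (root_kernel_square (r := s)); first by ring.
      by rewrite addrC.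
    by rewrite mulrC.
  by apply: eq_gram (gramZ c0 gK) => x y; rewrite addrK.
Qed.

Lemma srg_certificates_mul :
  (- s * n / (d%:R - s)) * (n * (1 + r) / (n - d%:R + r)) = n.
Proof.
have nn0 := lt0r_neq0 n_gt0; have ds0 := lt0r_neq0 ds_gt0.
have ndr0 := lt0r_neq0 ndr_gt0.
(* Since [(d - r) * (d - s) = m * n], the left side is [n * (d - s - m)], and [m - d = r * s]. *)
have key : (d%:R - s) * (n - d%:R + r) = n * (- s * (1 + r)).
  transitivity (n * (d%:R - s) - (d%:R * d%:R - (r + s) * d%:R + r * s)); first by ring.
  rewrite srg_count rs_add rs_mul.
  transitivity (n * (d%:R - s - m%:R)); first by ring.
  by congr (_ * _); rewrite mulrDr mulr1 mulNr [s * r]mulrC rs_mul; ring.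
transitivity (n * (n * (- s * (1 + r))) / ((d%:R - s) * (n - d%:R + r))).
  by field; rewrite ds0 ndr0.
by rewrite -key mulfK // mulf_neq0.
Qed.

End StronglyRegular.

Lemma strongly_regular_certificates (R : realType) (T : finType) (e : rel T) :
  simple_graph e -> strongly_regular e ->
  exists t u : R, [/\ t * u = #|T|%:R, certificate e t & certificate (compl_graph e) u].
Proof.
move=> [esym eirr] [d [l [m srg]]].
have [r [s [rsD rsM s0 r0]]] := srg_eigenvalues R eirr srg.
exists (- s * #|T|%:R / (d%:R - s)), (#|T|%:R * (1 + r) / (#|T|%:R - d%:R + r)).
split; first exact: (srg_certificates_mul esym eirr srg rsD rsM).
  exact: (srg_certificate esym eirr srg rsD rsM).
exact: (srg_certificate_compl esym eirr srg rsD rsM).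
Qed.

(** Here [r + s = -1] and [r - s] is the square root [w] of the order; substituting [r] and [s]
    turns both certificate values into [w]. *)
Lemma conference_certificates (R : realType) (T : finType) (e : rel T) :
  simple_graph e -> conference_graph e ->
  certificate e (Num.sqrt #|T|%:R : R) /\
  certificate (compl_graph e) (Num.sqrt #|T|%:R : R).
Proof.
move=> [esym eirr] [n5 [d [l [m [dn ln mn srg]]]]].
have [r [s [rsD rsM s0 r0]]] := srg_eigenvalues R eirr srg.
set w : R := Num.sqrt _.
have n0 : 0 < #|T|%:R :> R by rewrite ltr0n; exact: leq_trans n5.
have w0 : 0 < w by rewrite sqrtr_gt0.
have w2 : #|T|%:R = w ^+ 2 :> R by rewrite sqr_sqrtr // ltW.
clearbody w; have dE : d%:R = (w ^+ 2 - 1) / 2 :> R.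
  by rewrite -w2 -dn natrD natrM; field.
have lE : l%:R = (w ^+ 2 - 5) / 4 :> R.
  by rewrite -w2 -ln natrD natrM; field.
have mE : m%:R = (w ^+ 2 - 1) / 4 :> R.
  by rewrite -w2 -mn natrD natrM; field.
have rsw : r - s = w.
  have rs0 : 0 <= r - s by lra.
  apply/eqP; rewrite -(eqrXn2 (n := 2)) ?(ltW w0) //; apply/eqP.
  transitivity ((r + s) ^+ 2 - 4 * (r * s)); first by ring.
  by rewrite rsD rsM dE lE mE; field.
have rs1 : r + s = -1 by rewrite rsD lE mE; field.
have rE : r = (w - 1) / 2.
  by transitivity (((r - s) + (r + s)) / 2); [field | rewrite rs1 rsw].
have sE : s = - (w + 1) / 2.
  by transitivity ((- (r - s) + (r + s)) / 2); [field | rewrite rs1 rsw -opprD].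
have ce := srg_certificate esym eirr srg rsD rsM s0 r0.
have cc := srg_certificate_compl esym eirr srg rsD rsM s0 r0.
have w_neq0 : w != 0 by rewrite gt_eqF.
have w1_neq0 : w + 1 != 0 by rewrite gt_eqF // addr_gt0.
split.
  rewrite (_ : w = - s * #|T|%:R / (d%:R - s)) //.
  rewrite (_ : d%:R - s = w * (w + 1) / 2); last by rewrite dE sE; field.
  by rewrite w2 sE; field; rewrite w1_neq0 w_neq0.
rewrite (_ : w = #|T|%:R * (1 + r) / (#|T|%:R - d%:R + r)) //.
rewrite (_ : #|T|%:R - d%:R + r = w * (w + 1) / 2); last by rewrite w2 dE rE; field.
by rewrite w2 rE; field; rewrite w1_neq0 w_neq0.
Qed.

(** * Strong duality *)

Section NearestPoint.
Variables (R : realType) (T : finType) (N : rel T) (z : T -> T -> R).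
Hypothesis N_diag : forall x, N x x.
Implicit Types p c : T -> T -> R.

(** Squared Euclidean distance to [z] seen only through the entries in [N]; the other entries of [p]
    are free. *)
Definition dist2 p : R := \sum_i \sum_j (N i j)%:R * (p i j - z i j) ^+ 2.

(** Kernels as points of a product space, so that Tychonoff's theorem makes boxes compact. *)
Local Notation X := (prod_topology (fun _ : T * T => R)).

Let eval_continuous u : continuous (fun f : X => f u).
Proof. exact: (@proj_continuous _ (fun=> R) u). Qed.

Let sum_continuous (F : T -> T -> X -> R) :
  (forall i j, continuous (F i j)) -> continuous (fun f => \sum_i \sum_j F i j f).
Proof.
by move=> cF; apply: continuous_big => [|i _]; [exact: add_continuous |
  apply: continuous_big => [|j _]; [exact: add_continuous | exact: cF]].
Qed.

Let mul_continuous (F G : X -> R) :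
  continuous F -> continuous G -> continuous (fun f => F f * G f).
Proof.
by move=> cF cG f; exact: (@cvgM R X (nbhs f) _ F G _ _ (cF f) (cG f)).
Qed.

Let sub_continuous (F G : X -> R) :
  continuous F -> continuous G -> continuous (fun f => F f - G f).
Proof.
by move=> cF cG f; exact: (@cvgB R _ X (nbhs f) _ F G _ _ (cF f) (cG f)).
Qed.

Let curried (f : X) : T -> T -> R := fun i j => f (i, j).

Let bform_continuous (x : T -> R) : continuous (fun f => bform (curried f) x x).
Proof.
apply: sum_continuous => i j; apply: mul_continuous; last exact: eval_continuous.
exact: cst_continuous.
Qed.

Let dist2_continuous : continuous (fun f => dist2 (curried f)).
Proof.
have h i j : continuous (fun f => curried f i j - z i j).
  by apply: sub_continuous; [exact: eval_continuous | exact: cst_continuous].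
apply: sum_continuous => i j; apply: mul_continuous; first exact: cst_continuous.
exact: mul_continuous (h i j) (h i j).
Qed.

Let psd_closed : closed [set f : X | psd_kernel (curried f)]%classic.
Proof.
rewrite (_ : mkset _ =
   (\bigcap_(u in [set: T * T]) [set f : X | f u - f (u.2, u.1) = 0]) `&`
   (\bigcap_(x in [set: T -> R]) [set f : X | 0 <= bform (curried f) x x]))%classic.
  apply: closedI; apply: closed_bigI => u _.
    apply: (@preimage_closed _ _ (fun f : X => f u - f (u.2, u.1)) [set 0]%classic).
      by move=> f _; apply: sub_continuous; exact: eval_continuous.
    exact: closed_eq.
  apply: (@preimage_closed _ _ (fun f : X => bform (curried f) u u)
      [set r | 0 <= r]%classic).
    by move=> f _; exact: bform_continuous.
  exact: closed_ge.
apply/seteqP; split=> f /=.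
  move=> [fs fp]; split=> [[i j] _|x _]; last exact: fp.
  by apply/eqP; rewrite /= subr_eq0; apply/eqP/fs.
move=> [fs fp]; split=> [i j|x]; last exact: fp.
by apply/eqP; rewrite -subr_eq0; apply/eqP; have := fs (i, j) I.
Qed.

(** Although [dist2] ignores entries outside [N], it sees the diagonal, which controls all entries
    of a positive semidefinite kernel. A minimum over a compact box is therefore global. *)
Lemma psd_kernel_nearest : exists2 p, psd_kernel p &
  forall p', psd_kernel p' -> dist2 p <= dist2 p'.
Proof.
pose o (_ _ : T) : R := 0; pose F := dist2 o.
have F0 : 0 <= F.
  by apply: sumr_ge0 => i _; apply: sumr_ge0 => j _; rewrite mulr_ge0 ?sqr_ge0.
(* A kernel with a diagonal entry above [c] is at squared distance at least [(F + 1) ^ 2], no better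
   than the zero kernel, whose value is [F]. *)
pose c : R := \sum_x `|z x x| + F + 1.
have zc a : z a a <= \sum_x `|z x x|.
  by rewrite (bigD1 a) //=; apply: (le_trans (ler_norm _)); rewrite lerDl sumr_ge0.
have c0 : 0 <= c by rewrite !addr_ge0 // sumr_ge0.
pose A := ([set f : X | forall u, `[- c, c]%classic (f u)] `&`
           [set f : X | psd_kernel (curried f)])%classic.
have A0 : A (fun=> 0).
  by split; [move=> u; rewrite /= in_itv /= oppr_le0 c0 | exact: psd_kernel0].
have cA : compact A.
  apply: compact_closedI; last exact: psd_closed.
  apply: (@tychonoff (T * T)%type (fun=> R) (fun=> `[- c, c]%classic)) => u.
  exact: segment_compact.
have [||p pA pmin] := @compact_EVT_min _ R (fun f => dist2 (curried f)) A _ cA.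
- by exists (fun=> 0).
- by apply: continuous_subspaceT; exact: dist2_continuous.
move: pA; rewrite inE => -[_ psdp]; exists (curried p) => // p' psdp'.
have [h|/existsNP[a /negP]] := pselect (forall a, p' a a <= c).
  apply: (pmin (fun u => p' u.1 u.2)); rewrite inE; split=> // u.
  rewrite /= in_itv /=.
  have := psd_kernel_le_diag u.1 u.2 psdp'; have := psd_kernel_ge_diag u.1 u.2 psdp'.
  by have := h u.1; have := h u.2; lra.
rewrite -ltNge => pa.
have : dist2 (curried p) <= F by apply: (pmin (fun=> 0)); rewrite inE.
move=> /le_trans; apply.
have Fle : F + 1 <= p' a a - z a a by have := zc a; rewrite /c in pa; lra.
apply: (@le_trans _ _ ((p' a a - z a a) ^+ 2)).
  apply: (@le_trans _ _ ((F + 1) ^+ 2)); first by rewrite sqrrD1; have := sqr_ge0 F; lra.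
  by rewrite ler_pXn2r ?nnegrE //; lra.
rewrite /dist2 (bigD1 a) //= (bigD1 a) //= N_diag mul1r -addrA lerDl addr_ge0 //.
  by rewrite sumr_ge0 // => j _; rewrite mulr_ge0 ?sqr_ge0.
by rewrite sumr_ge0 // => i _; rewrite sumr_ge0 // => j _; rewrite mulr_ge0 ?sqr_ge0.
Qed.

(* [q] is the residual of the projection of [z] on the closed convex cone of kernels that
   agree on [N] with a positive semidefinite one; it lies in the dual cone. *)
Lemma psd_kernel_residual (N_sym : symmetric N) (z_sym : forall i j, z i j = z j i) :
  exists2 p, psd_kernel p &
  let q i j := (N i j)%:R * (p i j - z i j) in
  psd_kernel q /\ \sum_i \sum_j q i j * z i j = - \sum_i \sum_j q i j ^+ 2.
Proof.
have [p psdp pmin] := psd_kernel_nearest; exists p => // q.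
pose inner c := \sum_i \sum_j q i j * c i j.
have dist2D (c : T -> T -> R) h : dist2 (fun i j => p i j + h * c i j) =
    dist2 p + (2 * h * inner c + h ^+ 2 * \sum_i \sum_j (N i j)%:R * c i j ^+ 2).
  rewrite /dist2 /inner !mulr_sumr -!big_split; apply: eq_bigr => i _ /=.
  rewrite !mulr_sumr -!big_split; apply: eq_bigr => j _ /=; rewrite /q; ring.
have inner_ge0 c : psd_kernel c -> 0 <= inner c.
  move=> psdc; apply: slope_ge0 => h h0 _.
  have := pmin _ (psd_kernelD (ltW h0) psdp psdc).
  by rewrite dist2D lerDl; exact.
(* Moving from [p] towards 0 stays in the cone for steps up to 1, which gives the opposite
   inequality. *)
have inner_p : inner p = 0.
  apply/eqP; rewrite eq_le inner_ge0 // andbT -oppr_ge0.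
  apply: (@slope_ge0 _ (\sum_i \sum_j (N i j)%:R * p i j ^+ 2)) => h h0 h1.
  have psdh : psd_kernel (fun i j => p i j + - h * p i j).
    have h1' : 0 <= 1 - h by rewrite subr_ge0.
    have [s sp] := psd_kernelZ h1' psdp.
    have E i j : p i j + - h * p i j = (1 - h) * p i j by ring.
    split=> [i j|x]; first by rewrite !E s.
    by have := sp x; under eq_fun do under eq_fun do rewrite -E.
  have := pmin _ psdh; rewrite dist2D lerDl; congr (0 <= _); ring.
split.
  have [ps _] := psdp.
  split=> [i j|x]; first by rewrite /q N_sym ps z_sym.
  have := inner_ge0 _ (psd_kernel_rank1 x).
  suff -> : inner (fun i j => x i * x j) = bform q x x by [].
  by apply: eq_bigr => i _; apply: eq_bigr => j _; rewrite mulrC.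
(* On [N] one has [z = p - q], and [q] vanishes elsewhere; the pairing of [q] with [p] is 0. *)
apply/eqP; rewrite -addr_eq0 -[X in _ == X]inner_p /inner; apply/eqP.
rewrite -big_split; apply: eq_bigr => i _ /=; rewrite -big_split.
apply: eq_bigr => j _ /=; rewrite /q; case: (N i j) => /=; ring.
Qed.

End NearestPoint.

(** Project [z = t I - J], ignoring the entries on edges. A zero residual makes [p + 1] a
    certificate; a nonzero residual [q] is feasible and [t * trace q - mass q] is its pairing with
    [z], which is negative. *)
Lemma certificate_or_feasible (R : realType) (T : finType) (e : rel T) (t : R) :
  simple_graph e -> certificate e t \/
  exists K : T -> T -> R, feasible e K /\ t * trace K < mass K.
Proof.
move=> [esym eirr].
pose N x y := ~~ e x y; pose z (x y : T) : R := t * (x == y)%:R - 1.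
have [|||p psdp] := @psd_kernel_residual R T N z.
- by move=> x; rewrite /N eirr.
- by move=> x y; rewrite /N esym.
- by move=> x y; rewrite /z eq_sym.
set q := fun i j => _; move=> /= [psdq qz].
have q_ge0 i j : 0 <= q i j ^+ 2 by exact: sqr_ge0.
have [q0|q_neq0] := eqVneq (\sum_i \sum_j q i j ^+ 2) 0.
  have {}q0 i j : q i j = 0.
    apply/eqP; rewrite -sqrf_eq0 eq_le q_ge0 andbT -q0.
    rewrite (bigD1 i) //= (bigD1 j) //= -addrA lerDl addr_ge0 ?sumr_ge0 //.
    by move=> k _; rewrite sumr_ge0.
  left; exists (fun x y => p x y + 1).
  have pz x y : N x y -> p x y = z x y.
    by move=> Nxy; have /eqP := q0 x y; rewrite /q Nxy mul1r subr_eq0 => /eqP.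
  split.
  - by move=> x; rewrite pz /N ?eirr // /z eqxx mulr1 subrK.
  - by move=> x y xy exy; rewrite pz // /z (negPf xy) mulr0 sub0r addNr.
  - by apply: eq_gram (psd_kernel_gram psdp) => x y; rewrite addrK.
right; exists q; split; first split=> // x y exy; first by rewrite /q /N exy mul0r.
rewrite -subr_lt0.
have -> : t * trace q - mass q = - \sum_i \sum_j q i j ^+ 2.
  rewrite -qz /trace /mass mulr_sumr -sumrB; apply: eq_bigr => i _.
  rewrite /z; under [RHS]eq_bigr do rewrite mulrBr mulr1.
  rewrite sumrB; congr (_ - _).
  rewrite (bigD1 i) //= eqxx mulr1 big1 ?addr0 1?mulrC // => j ji.
  by rewrite eq_sym (negPf ji) !mulr0.
rewrite oppr_lt0 lt_def q_neq0 sumr_ge0 // => i _.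
by rewrite sumr_ge0.
Qed.

Lemma certificate_lovasz_theta (R : realType) (T : finType) (e : rel T) :
  simple_graph e -> certificate e (lovasz_theta R e).
Proof.
move=> se; have [//|[K [fK]]] := certificate_or_feasible (lovasz_theta R e) se.
by rewrite ltNge mass_le_theta.
Qed.

(** * Vertex-transitive graphs *)

Lemma compl_graph_simple (T : finType) (e : rel T) :
  simple_graph e -> simple_graph (compl_graph e).
Proof.
move=> [esym eirr]; split=> [x y|x]; first by rewrite /compl_graph eq_sym esym.
by rewrite /compl_graph eqxx.
Qed.

Section Averaging.
Variables (R : realType) (T : finType) (e : rel T).
Hypothesis T_gt0 : (0 < #|T|)%N.
Implicit Types K C : T -> T -> R.

Local Notation n := (#|T|%:R : R).

Let n_gt0 : 0 < n. Proof. by rewrite ltr0n. Qed.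

(** The constants are an eigenvector of [K], so the new form at [x] is the form of [K] at [x] minus
    its mean. *)
Lemma psd_kernel_sub_mean K rho : psd_kernel K -> (forall x, \sum_y K x y = rho) ->
  psd_kernel (fun x y => K x y + - (rho / n) * 1).
Proof.
move=> [Ks Kp] Kr; split=> [x y|x]; first by rewrite Ks.
pose s := \sum_i x i.
have Kx1 : bform K x (fun=> 1) = s * rho.
  rewrite bform_sum mulr_suml; apply: eq_bigr => i _; rewrite -(Kr i).
  by congr (_ * _); apply: eq_bigr => j _; rewrite mul1r.
have K11 : bform K (fun=> 1) (fun=> 1) = n * rho.
  by rewrite bform_const1 /mass; under eq_bigr do rewrite Kr; rewrite sumr_const mulr_natl.
have J : bform (fun _ _ => 1) x x = s ^+ 2.
  rewrite /bform /s expr2 big_distrl; apply: eq_bigr => i _ /=.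
  by rewrite big_distrr; apply: eq_bigr => j _; rewrite mulr1.
have := Kp (fun i => x i + - (s / n) * 1).
rewrite (bform_addZ _ x (fun=> 1)) // Kx1 K11 bform_lin J.
congr (0 <= _); field; exact: lt0r_neq0.
Qed.

(** Pair [K - rho / n] with [C]: the supports of [K] and [C] meet only on the diagonal. *)
Lemma homogeneous_mass_mul_le K C delta rho :
  feasible (compl_graph e) K -> feasible e C ->
  (forall x, K x x = delta) -> (forall x, \sum_y K x y = rho) ->
  mass K * mass C <= n * (trace K * trace C).
Proof.
move=> [psdK K0] [psdC C0] Kd Kr.
have := gram_inner_ge0 (psd_kernel_gram (psd_kernel_sub_mean psdK Kr)) psdC.
have -> : \sum_i \sum_j (K i j + - (rho / n) * 1) * C i j =
    delta * trace C - rho / n * mass C.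
  rewrite /trace /mass !mulr_sumr -sumrB; apply: eq_bigr => i _.
  under eq_bigr do rewrite mulr1 mulrDl mulNr.
  rewrite sumrB -mulr_sumr; congr (_ - _).
  rewrite (bigD1 i) //= Kd big1 ?addr0 // => j ji.
  have [/C0 ->|eij] := boolP (e i j); first by rewrite mulr0.
  by rewrite K0 ?mul0r // /compl_graph eq_sym ji.
have -> : mass K = n * rho.
  by rewrite /mass; under eq_bigr do rewrite Kr; rewrite sumr_const mulr_natl.
have -> : trace K = n * delta.
  by rewrite /trace; under eq_bigr do rewrite Kd; rewrite sumr_const mulr_natl.
rewrite -(pmulr_rge0 _ (mulr_gt0 n_gt0 n_gt0)) => h; rewrite -subr_ge0; move: h.
congr (0 <= _); field; exact: lt0r_neq0.
Qed.

Definition automorphisms : {set {perm T}} :=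
  [set s : {perm T} | [forall u, forall v, e (s u) (s v) == e u v]].

Lemma automorphismsP (s : {perm T}) :
  reflect (forall u v, e (s u) (s v) = e u v) (s \in automorphisms).
Proof.
rewrite inE; apply: (iffP forallP) => h u.
  by move=> v; apply/eqP; move/forallP: (h u).
by apply/forallP => v; rewrite h.
Qed.

Lemma automorphismsMl (s t : {perm T}) : t \in automorphisms ->
  ((t * s)%g \in automorphisms) = (s \in automorphisms).
Proof.
move=> /automorphismsP et; apply/automorphismsP/automorphismsP => h u v.
  by have := h (t^-1 u)%g (t^-1 v)%g; rewrite !permM !permKV => ->; rewrite -et !permKV.
by rewrite !permM h et.
Qed.

(** Left as a sum: the order of the group cancels in the homogeneous inequality on mass and
    trace. *)
Definition average K x y : R := \sum_(s in automorphisms) K (s x) (s y).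

Lemma average_invariant K (t : {perm T}) x y : t \in automorphisms ->
  average K (t x) (t y) = average K x y.
Proof.
move=> tA; rewrite /average [RHS](reindex_inj (mulgI t)).
apply: eq_big => [s|s _]; first by rewrite automorphismsMl.
by rewrite !permM.
Qed.

Lemma psd_average K : psd_kernel K -> psd_kernel (average K).
Proof.
move=> psdK; split=> [x y|x].
  by apply: eq_bigr => s _; case: psdK => Ks _; rewrite Ks.
have -> : bform (average K) x x =
    \sum_(s in automorphisms) bform (fun i j => K (s i) (s j)) x x.
  rewrite /bform [RHS]exchange_big; apply: eq_bigr => i _ /=.
  by rewrite [RHS]exchange_big; apply: eq_bigr => j _ /=; rewrite mulr_sumr.
apply: sumr_ge0 => s _.
by have [_] := gram_psd (gram_pullback s (psd_kernel_gram psdK)); exact.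
Qed.

Lemma trace_average K : trace (average K) = #|automorphisms|%:R * trace K.
Proof.
rewrite /trace exchange_big /= -sumr_const mulr_suml; apply: eq_bigr => s _.
by rewrite mul1r [RHS](reindex_inj (@perm_inj _ s)).
Qed.

Lemma mass_average K : mass (average K) = #|automorphisms|%:R * mass K.
Proof.
rewrite /mass; under eq_bigr do rewrite exchange_big.
rewrite exchange_big /= -sumr_const mulr_suml; apply: eq_bigr => s _.
rewrite mul1r [RHS](reindex_inj (@perm_inj _ s)); apply: eq_bigr => i _ /=.
by rewrite [RHS](reindex_inj (@perm_inj _ s)).
Qed.

Hypothesis e_transitive : vertex_transitive e.

(** Transitivity gives the averaged kernel a constant diagonal and constant row sums, while
    averaging multiplies mass and trace by the same factor. *)
Lemma vertex_transitive_mass_mul_le K C :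
  feasible (compl_graph e) K -> feasible e C ->
  mass K * mass C <= n * (trace K * trace C).
Proof.
move=> [psdK K0] fC; have /card_gt0P[a _] := T_gt0.
have trans x : exists2 t, t \in automorphisms & t a = x.
  by have [t [et tx]] := e_transitive a x; exists t => //; exact/automorphismsP.
have fA : feasible (compl_graph e) (average K).
  split=> [|x y exy]; first exact: psd_average.
  rewrite /average big1 // => s /automorphismsP es; apply: K0.
  by move: exy; rewrite /compl_graph es (inj_eq perm_inj).
have := @homogeneous_mass_mul_le _ _ (average K a a) (\sum_y average K a y) fA fC.
rewrite mass_average trace_average -!mulrA [n * _]mulrCA ler_pM2l; last first.
  by rewrite ltr0n; apply/card_gt0P; exists 1%g; apply/automorphismsP => u v; rewrite !perm1.
apply=> x; have [t tA <-] := trans x; first exact: average_invariant.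
rewrite (reindex_inj (@perm_inj _ t)); apply: eq_bigr => y _.
exact: average_invariant.
Qed.

(** The values are the two thetas. Their product is at least [n] by [certificate_compl_theta_ge],
    and at most [n] by bounding each theta in turn over feasible kernels. *)
Lemma vertex_transitive_certificates : simple_graph e ->
  exists t u : R, [/\ t * u = n, certificate e t & certificate (compl_graph e) u].
Proof.
move=> se; have sc := compl_graph_simple se.
have [_ eirr] := se; have [_ cirr] := sc.
have ce : certificate e (lovasz_theta R e) := certificate_lovasz_theta R se.
have cc : certificate (compl_graph e) (lovasz_theta R (compl_graph e)) :=
  certificate_lovasz_theta R sc.
exists (lovasz_theta R e), (lovasz_theta R (compl_graph e)); split=> //.
apply/eqP; rewrite eq_le; apply/andP; split; last first.
  by rewrite mulrC; exact: certificate_compl_theta_ge.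
have t0 : 0 < lovasz_theta R e := lt_le_trans ltr01 (certificate_ge1 T_gt0 ce).
rewrite mulrC -ler_pdivlMr //; apply: lovasz_theta_le => // K fK.
rewrite mulrAC ler_pdivlMr //.
have nt0 : 0 <= n * trace K by rewrite mulr_ge0 ?trace_ge0 //; case: fK.
(* The second theta bound divides by [mass K], so a nonpositive mass is treated apart. *)
have [mK|mK] := lerP (mass K) 0.
  by apply: le_trans nt0; rewrite mulr_le0_ge0 // ltW.
rewrite mulrC -ler_pdivlMr //; apply: lovasz_theta_le => // C fC.
rewrite mulrAC ler_pdivlMr // mulrC -mulrA.
exact: vertex_transitive_mass_mul_le.
Qed.

End Averaging.

(** * Self-complementary graphs and the final assembly *)

Lemma card_le_powR (R : realType) (n k : nat) : (0 < n)%N -> (n <= 4 ^ k.+1)%N ->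
  n%:R <= 16 * powR n%:R ((k%:R - 1) / (k%:R + 1)) :> R.
Proof.
move=> n0 nk; have k1 : k%:R + 1 != 0 :> R by rewrite natr1 pnatr_eq0.
have n_neq0 : n%:R != 0 :> R by rewrite pnatr_eq0 -lt0n.
rewrite -{1}[n%:R](@powRr1 R) //.
(* The factor of exponent [2 / (k + 1)] is at most [4 ^ 2 = 16]. *)
rewrite [X in powR _ X <= _](_ : 1 = 2 / (k%:R + 1) + (k%:R - 1) / (k%:R + 1)); last first.
  by field.
rewrite powRD ?n_neq0 ?implybT // ler_wpM2r ?powR_ge0 //.
have e0 : 0 <= 2 / (k%:R + 1) :> R by rewrite divr_ge0 // natr1.
have nk' : n%:R <= 4 ^+ k.+1 :> R by rewrite -natrX ler_nat.
apply: (le_trans (ge0_ler_powR e0 _ _ nk')); rewrite ?nnegrE ?exprn_ge0 //.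
rewrite -powR_mulrn // -powRrM.
rewrite (_ : k.+1%:R * (2 / (k%:R + 1)) = 2%:R); last by rewrite -natr1; field.
by rewrite powR_mulrn // -natrX ler_nat.
Qed.

Lemma self_complementary_sqrt_le_shannon (R : realType) (T : finType) (e : rel T) :
  self_complementary e -> Num.sqrt #|T|%:R <= shannon_capacity R e.
Proof.
move=> /alpha_self_complementary h; apply: le_trans (sqrt_alpha_le_shannon R e).
by rewrite ler_sqrt // ler_nat.
Qed.

Lemma self_complementary_certificates (R : realType) (T : finType) (e : rel T) (t : R) :
  self_complementary e -> certificate e t <-> certificate (compl_graph e) t.
Proof.
move=> [s es]; split; last first.
  by apply: (certificate_pullback (@perm_inj _ s)) => x y; rewrite es.
by apply: (certificate_pullback (@perm_inj _ s^-1%g)) => x y; rewrite -es !permKV.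
Qed.

(** The lower bound is [n <= t * theta <= sqrt n * theta], with [n = #|T|]; the second step needs
    theta nonnegative, which follows from [alpha_le_theta]. *)
Lemma theta_eq_sqrt (R : realType) (T : finType) (e : rel T) (t : R) :
  irreflexive e -> (0 < #|T|)%N -> t <= Num.sqrt #|T|%:R ->
  certificate e t -> certificate (compl_graph e) t ->
  lovasz_theta R e = Num.sqrt #|T|%:R.
Proof.
move=> eirr T0 tw ce cc; apply/eqP; rewrite eq_le.
rewrite (le_trans (certificate_theta_le T0 eirr ce) tw) /=.
have w0 : 0 < Num.sqrt #|T|%:R :> R by rewrite sqrtr_gt0 ltr0n.
rewrite -(ler_pM2l w0) -expr2 sqr_sqrtr //.
apply: (le_trans (certificate_compl_theta_ge T0 eirr cc)); rewrite ler_wpM2r //.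
by apply: le_trans (alpha_le_theta R (alpha_gt0 eirr T0)).
Qed.

Lemma strong_prod_irreflexive (T1 T2 : finType) (e1 : rel T1) (e2 : rel T2) :
  irreflexive (strong_prod e1 e2).
Proof. by move=> x; rewrite /strong_prod eqxx. Qed.

Theorem mainTheorem1 (R : realType) (T : finType) (e : rel T) :
  simple_graph e -> (0 < #|T|)%N ->
  let n : R := (#|T|)%:R in
  let GGc := strong_prod e (compl_graph e) in
  [/\ (vertex_transitive e \/ strongly_regular e) ->
        [/\ alpha GGc = #|T|, shannon_capacity R GGc = n & lovasz_theta R GGc = n],
      conference_graph e -> lovasz_theta R e = Num.sqrt n,
      self_complementary e ->
        Num.sqrt n <= shannon_capacity R e /\
        shannon_capacity R e <=
          16 * powR n (((alpha e)%:R - 1) / ((alpha e)%:R + 1))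
    & self_complementary e -> (vertex_transitive e \/ strongly_regular e) ->
        [/\ shannon_capacity R e = Num.sqrt n,
            lovasz_theta R e = Num.sqrt n,
            Num.sqrt (alpha (strong_prod e e))%:R = shannon_capacity R e
          & forall (T' : finType) (e' : rel T'),
              simple_graph e' -> #|T'| = #|T| -> self_complementary e' ->
              shannon_capacity R e <= shannon_capacity R e']].
Proof.
move=> se T0 n GGc; have [esym eirr] := se.
have certs : vertex_transitive e \/ strongly_regular e ->
    exists t u : R, [/\ t * u = n, certificate e t & certificate (compl_graph e) u].
  by case=> h; [exact: vertex_transitive_certificates | exact: strongly_regular_certificates].
have n0 : 0 <= n by exact: ler0n.
split.
- move=> /certs[t [u [tu ce cc]]].
  (* The product certificate bounds all three quantities by [n], and the diagonal gives the matching
     lower bound. *)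
  have cp : certificate GGc n by rewrite -tu; exact: certificate_strong_prod.
  have aG : alpha GGc = #|T|.
    apply/eqP; rewrite eqn_leq alpha_diagonal // andbT -(ler_nat R).
    exact: certificate_alpha_le cp.
  split=> //; apply/eqP; rewrite eq_le; apply/andP; split.
  + exact: certificate_shannon_le.
  + by rewrite /n -aG; exact: alpha_le_shannon.
  + apply: certificate_theta_le cp; first by rewrite card_prod muln_gt0 T0.
    exact: strong_prod_irreflexive.
  + by rewrite /n -aG; apply: alpha_le_theta; rewrite aG.
- by move=> /(conference_certificates R se) [ce cc]; exact: theta_eq_sqrt ce cc.
- move=> esc; split; first exact: self_complementary_sqrt_le_shannon.
  apply: le_trans (shannon_capacity_le_card _ _) _.
  by apply: card_le_powR => //; exact: self_complementary_card_le.
move=> esc /certs[t [u [tu ce cc]]].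
(* Self-complementarity makes both [t] and [u] certificate values for [e]; since [t * u = n], the
   smaller is at most [sqrt n]. *)
have [w [w0 wn cw]] : exists w : R, [/\ 0 <= w, w <= Num.sqrt n & certificate e w].
  have cu : certificate e u by apply/(self_complementary_certificates u esc).
  have t0 : 0 <= t := le_trans ler01 (certificate_ge1 T0 ce).
  have u0 : 0 <= u := le_trans ler01 (certificate_ge1 T0 cu).
  have small v : 0 <= v -> v * v <= n -> v <= Num.sqrt n.
    by move=> v0 vn; rewrite -(ger0_norm v0) -sqrtr_sqr ler_sqrt // expr2.
  have [le_tu|lt_ut] := leP t u.
    by exists t; split=> //; apply: small => //; rewrite -tu ler_wpM2l.
  by exists u; split=> //; apply: small => //; rewrite -tu ler_wpM2r // ltW.
have shE : shannon_capacity R e = Num.sqrt n.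
  apply/eqP; rewrite eq_le self_complementary_sqrt_le_shannon // andbT.
  exact: le_trans (certificate_shannon_le w0 cw) wn.
split=> //.
- exact: theta_eq_sqrt eirr T0 wn cw (proj1 (self_complementary_certificates w esc) cw).
- apply/eqP; rewrite eq_le sqrt_alpha_le_shannon shE ler_sqrt // ler_nat.
  exact: alpha_self_complementary.
- by move=> T' e' _ cardT' esc'; rewrite shE /n -cardT' self_complementary_sqrt_le_shannon.
Qed.
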